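(* Let $M$ and $M'$ be two germs at the origin of real-analytic hypersurfaces of $\mathbb{C}^2$, of equations $v=z\overline{z}+\mathrm{O}(6)$ and $v'=z'\overline{z}'+\mathrm{O}(6)$ (weighted remainders). Let \[ z'=f(z,w)+\mathrm{O}(5),\qquad w'=g(z,w)+\mathrm{O}(6) \] be a local biholomorphism fixing the origin and sending $M$ to $M'$, where $f$ and $g$ are polynomials having only monomials of weight $\leqslant 4$ and $\leqslant 5$, respectively. Then there exist $\lambda\in\mathbb{C}\setminus\{0\}$, $\alpha\in\mathbb{C}$, $r\in\mathbb{R}$ such that \[ \begin{aligned} f&=\lambda z+2i\lambda\overline{\alpha}\,z^2-4\lambda\overline{\alpha}^2\,z^3-8i\lambda\overline{\alpha}^3\,z^4+\lambda\alpha\,w+\big(3i\lambda\alpha\overline{\alpha}+\lambda r\big)\,zw\\ &\quad+\big(-8\lambda\alpha\overline{\alpha}^2+4i\overline{\alpha}\lambda r\big)\,z^2w+\big(\lambda\alpha r+i\lambda\alpha^2\overline{\alpha}\big)\,w^2,\\ g&=\lambda\overline{\lambda}\,w+2i\lambda\overline{\lambda}\overline{\alpha}\,zw-4\lambda\overline{\lambda}\overline{\alpha}^2\,z^2w-8i\lambda\overline{\lambda}\overline{\alpha}^3\,z^3w\\ &\quad+\big(i\lambda\overline{\lambda}\alpha\overline{\alpha}+\lambda\overline{\lambda}r\big)\,w^2+\big(4i\lambda\overline{\lambda}\overline{\alpha}r-4\lambda\overline{\lambda}\overline{\alpha}^2\alpha\big)\,zw^2. \end{aligned} \]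
   Context: Coordinates on the source $\mathbb{C}^2$ are $(z,w)$ with $w=u+iv$, and on the target $(z',w')$ with $w'=u'+iv'$. Weights are $[z]=[\overline{z}]=1$, $[w]=[\overline{w}]=2$, $[u]=2$, and similarly for primed coordinates. In equations of hypersurfaces, $\mathrm{O}(6)$ denotes a convergent power series in $(z,\overline{z},u)$ (resp. $(z',\overline z',u')$) all of whose monomials $z^j\overline{z}^ku^l$ have weight $j+k+2l\geqslant 6$. In holomorphic maps, $\mathrm{O}(\nu)$ denotes a convergent power series in $(z,w)$ all of whose monomials $z^jw^l$ have weight $j+2l\geqslant\nu$. *)

(* Defs.v *)
From Stdlib Require Export Reals.
From Coquelicot Require Export Coquelicot.
Open Scope R_scope.
Open Scope C_scope.

(* Germs at the origin are represented by total functions (or predicates) of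
   which only the behaviour near the origin is constrained. *)

Definition C2 : UniformSpace := prod_UniformSpace C_UniformSpace C_UniformSpace.

Definition origin : C2 := (RtoC 0, RtoC 0).

(* [h] is, near the origin, the sum of the power series
   [sum_(j,l) c j l z^j w^l], which converges absolutely on a closed bidisc of
   radius [r > 0].  The terms are grouped by total degree [n = j + l]; by
   absolute convergence the grouping is immaterial. *)
Definition power_series2 (c : nat -> nat -> C) (h : C -> C -> C) : Prop :=
  exists r : R, (0 < r)%R /\
    ex_series (fun n : nat =>
      sum_n (fun j : nat => (Cmod (c j (n - j)%nat) * r ^ n)%R) n) /\
    forall z w : C, (Cmod z < r)%R -> (Cmod w < r)%R ->
      is_series (fun n : nat =>
        sum_n (fun j : nat => c j (n - j)%nat * z ^ j * w ^ (n - j)) n) (h z w).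

(* The same for a real-valued [h] and the power series
   [sum_(j,k,l) c j k l z^j (Cconj z)^k u^l], with [u] real. *)
Definition power_series3 (c : nat -> nat -> nat -> C) (h : C -> R -> R) : Prop :=
  exists r : R, (0 < r)%R /\
    ex_series (fun n : nat =>
      sum_n (fun j : nat =>
        sum_n (fun k : nat =>
          (Cmod (c j k (n - j - k)%nat) * r ^ n)%R) (n - j)%nat) n) /\
    forall (z : C) (u : R), (Cmod z < r)%R -> (Rabs u < r)%R ->
      is_series (fun n : nat =>
        sum_n (fun j : nat =>
          sum_n (fun k : nat =>
            c j k (n - j - k)%nat * z ^ j * Cconj z ^ k
              * RtoC u ^ (n - j - k)) (n - j)%nat) n) (RtoC (h z u)).

(* Weights: 1 for [z] and [Cconj z], 2 for [w] and [u]. *)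
Definition weighted_O2 (nu : nat) (h : C -> C -> C) : Prop :=
  exists c : nat -> nat -> C,
    (forall j l : nat, (j + 2 * l < nu)%nat -> c j l = RtoC 0) /\
    power_series2 c h.

Definition weighted_O3 (nu : nat) (h : C -> R -> R) : Prop :=
  exists c : nat -> nat -> nat -> C,
    (forall j k l : nat, (j + k + 2 * l < nu)%nat -> c j k l = RtoC 0) /\
    power_series3 c h.

(* Monomials of weight at most [d] have both exponents at most [d]. *)
Definition weighted_poly (d : nat) (f : C -> C -> C) : Prop :=
  exists a : nat -> nat -> C,
    (forall j l : nat, (d < j + 2 * l)%nat -> a j l = RtoC 0) /\
    forall z w : C,
      f z w = sum_n (fun j : nat =>
                sum_n (fun l : nat => a j l * z ^ j * w ^ l) d) d.

(* The germ at the origin of [M] is the real-analytic hypersurface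
   [v = z * Cconj z + O(6)], where [w = u + i v]. *)
Definition hypersurface_germ (M : C2 -> Prop) : Prop :=
  exists rho : C -> R -> R, weighted_O3 6 rho /\
    locally origin (fun p : C2 =>
      M p <->
      RtoC (Im (snd p)) =
        fst p * Cconj (fst p) + RtoC (rho (fst p) (Re (snd p)))).

Definition holomorphic_germ (h : C -> C -> C) : Prop :=
  exists c : nat -> nat -> C, power_series2 c h.

Definition holomorphic_map_germ (H : C2 -> C2) : Prop :=
  holomorphic_germ (fun z w : C => fst (H (z, w))) /\
  holomorphic_germ (fun z w : C => snd (H (z, w))).

Definition local_biholomorphism (H : C2 -> C2) : Prop :=
  holomorphic_map_germ H /\ H origin = origin /\
  exists K : C2 -> C2,
    holomorphic_map_germ K /\ K origin = origin /\
    locally origin (fun p : C2 => K (H p) = p) /\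
    locally origin (fun p : C2 => H (K p) = p).

(* Equality of germs [H(M) = M'], for [H] a local biholomorphism. *)
Definition sends_germ (H : C2 -> C2) (M M' : C2 -> Prop) : Prop :=
  locally origin (fun p : C2 => M p <-> M' (H p)).

(* Main.v *)
Require Import Defs.
From Stdlib Require Import Reals.
From Coquelicot Require Import Coquelicot.
From Stdlib Require Import Lra Lia List.
Import ListNotations.
Open Scope R_scope.
Open Scope C_scope.

(** The hypersurface [v = z * Cconj z] is a model for both germs up to weight
    5, so the weighted jet of [H] must map the model to itself up to weight 5.

    Fix [z0] and a real [u0], put [w0 = u0 + i z0 Cconj z0], and follow the
    curve of [M] with [z = t z0] and [u = t^2 u0] as [t] tends to [0+].  Its
    second coordinate is [t^2 w0 + O(t^6)], so a monomial of weight [k] in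
    [(z, w)] becomes [t^k] times its value at [(z0, w0)], and the equation of
    [M'] becomes [Im (G - i F Cconj F) = O(t^6)] for [H = (F, G)]
    ([mapping_equation_on_curve]).  Since [Im (i F Cconj F)] is [|F|^2], the
    whole equation is the imaginary part of a polynomial in [t]; its
    coefficients of [t^k], [k <= 5], vanish ([weight_equations],
    [jet_equations]).  One difficulty is circular: the remainder of [M'] is
    only known to be [O(t^6)] once [G = O(t^2)].  A cruder bound [O(t^3)] holds
    in any case, and it already kills the only term of weight 1 in [G].

    Each equation, one per weight, then holds for all [z0] and [u0].  After
    conjugating the terms with more [Cconj z] than [z], it reads
    [Im (sum of p_jkl z^j (Cconj z)^k u^l) = 0] with [j >= k], which forces
    [p_jkl = 0] for [j > k] and [Im p_jjl = 0] ([Im_odd_weight_zero],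
    [Im_even_weight_zero]).  Factoring the coefficient [lambda] of [z] out of
    [f], and [lambda * Cconj lambda] out of [g], reduces to the case
    [lambda = 1], where these relations form a triangular linear system, solved
    weight by weight ([weight2_relations] to [weight5_relations]).  The
    parameters left free are the coefficient [alpha] of [w] in [f], in weight
    3, and the real part [r] of the coefficient of [z w], in weight 4; with
    [lambda] they parametrise the isotropy group of the model, and weight 5 adds
    no further parameter.  Finally [lambda <> 0] because the inverse of [H] could not
    recover [t] from [H (t, 0) = O(t^2)]. *)

(** * Weighted growth of power series *)

Lemma Cmod_is_series_le (a : nat -> C) (b : nat -> R) (l : C) :
  is_series a l -> ex_series b -> (forall n, (Cmod (a n) <= b n)%R) ->
  (Cmod l <= Series b)%R.
Proof.
  intros Ha Hb Hab.
  assert (Hlim : is_lim_seq (fun n => norm (sum_n a n)) (norm l)).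
  { apply (filterlim_comp _ _ _ _ _ _ _ _ Ha (filterlim_norm l)). }
  exact (is_lim_seq_le _ (sum_n b) _ (Series b)
    (fun n => Rle_trans _ _ _ (norm_sum_n_m a 0 n)
                (sum_n_m_le (fun k => norm (a k)) b 0 n Hab))
    Hlim (Series_correct _ Hb)).
Qed.

Lemma Cmod_sum_n_le (a : nat -> C) (b : nat -> R) (N : nat) :
  (forall n, (n <= N)%nat -> (Cmod (a n) <= b n)%R) -> (Cmod (sum_n a N) <= sum_n b N)%R.
Proof.
  intros Hab.
  induction N as [|N IH].
  - rewrite !sum_O. apply Hab. lia.
  - rewrite !sum_Sn.
    eapply Rle_trans; [apply Cmod_triangle|].
    apply Rplus_le_compat; [apply IH; intros; apply Hab; lia | apply Hab; lia].
Qed.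

Lemma pow_le_pow (x : R) (n p : nat) :
  (0 <= x <= 1)%R -> (n <= p)%nat -> (x ^ p <= x ^ n)%R.
Proof.
  intros Hx Hnp. replace p with (n + (p - n))%nat by lia.
  rewrite pow_add. rewrite <- (Rmult_1_r (x ^ n)) at 2.
  apply Rmult_le_compat_l; [apply pow_le; lra|].
  rewrite <- (pow1 (p - n)). apply pow_incr; lra.
Qed.

(** The weights [a] of [x] and [b] of [y] are free because three choices are
    used: [(1, 2)] for the weights of the problem, and [(1, 1)] and [(2, 2)]
    for the crude bounds where only first-order smallness is known.  Writing
    [s = e * (s / e)] with [e <= 1] and [e < r], the powers of [e] are bounded
    by those of the radius [r], and the powers of [s / e <= 1] by the [nu]-th. *)
Lemma monomial_decay (r : R) (a b nu : nat) :
  (0 < r)%R -> (0 < a)%nat -> (0 < b)%nat ->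
  exists e : R, (0 < e)%R /\ forall x y s : R,
    (0 <= s <= e)%R -> (0 <= x <= s ^ a)%R -> (0 <= y <= s ^ b)%R ->
    (x < r)%R /\ (y < r)%R /\
    forall j l, (nu <= a * j + b * l)%nat ->
      (x ^ j * y ^ l <= r ^ (j + l) * (s / e) ^ nu)%R.
Proof.
  intros Hr Ha Hb.
  (* Half the minimum gives [e < r] strictly, as the series is only controlled
     inside the bidisc. *)
  set (e := (Rmin r 1 / 2)%R).
  assert (He : (0 < e)%R /\ (e < r)%R /\ (e < 1)%R).
  { unfold e. pose proof (Rmin_l r 1). pose proof (Rmin_r r 1).
    assert (0 < Rmin r 1)%R by (apply Rmin_pos; lra). lra. }
  destruct He as [He0 [Her He1]].
  exists e. split; [exact He0|]. intros x y s Hs Hx Hy.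
  pose proof (pow_le_pow s 1 a ltac:(lra) Ha).
  pose proof (pow_le_pow s 1 b ltac:(lra) Hb).
  split; [lra|]. split; [lra|]. intros j l Hnu.
  set (m := (a * j + b * l)%nat) in *.
  assert (Hq : (0 <= s / e <= 1)%R).
  { split; [apply Rdiv_le_0_compat; lra|].
    apply (Rmult_le_reg_r e); [lra|]. unfold Rdiv. rewrite Rmult_assoc, Rinv_l; lra. }
  apply Rle_trans with (s ^ m)%R.
  { unfold m. rewrite pow_add, !pow_mult.
    apply Rmult_le_compat; try (apply pow_le; lra); apply pow_incr; lra. }
  replace (s ^ m)%R with (e ^ m * (s / e) ^ m)%R
    by (rewrite <- Rpow_mult_distr; f_equal; field; lra).
  apply Rmult_le_compat.
  - apply pow_le; lra.
  - apply pow_le; lra.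
  - apply Rle_trans with (e ^ (j + l))%R.
    + apply pow_le_pow; [lra|]. unfold m. nia.
    + apply pow_incr; lra.
  - apply pow_le_pow; [lra|exact Hnu].
Qed.

(** Every surviving monomial gains [(s / e)^nu], so the sum is at most that
    factor times the absolutely convergent series at radius [r]. *)
Lemma power_series2_bound (c : nat -> nat -> C) (h : C -> C -> C) (a b nu : nat) :
  (0 < a)%nat -> (0 < b)%nat ->
  (forall j l, (a * j + b * l < nu)%nat -> c j l = RtoC 0) ->
  power_series2 c h ->
  exists e K : R, (0 < e)%R /\ forall (z w : C) (s : R), (0 <= s <= e)%R ->
    (Cmod z <= s ^ a)%R -> (Cmod w <= s ^ b)%R -> (Cmod (h z w) <= K * s ^ nu)%R.
Proof.
  intros Ha Hb Hc [r [Hr [HS Hh]]].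
  set (S := fun n => sum_n (fun j => (Cmod (c j (n - j)%nat) * r ^ n)%R) n) in HS.
  destruct (monomial_decay r a b nu Hr Ha Hb) as [e [He Hdecay]].
  exists e, (Series S * (/ e) ^ nu)%R. split; [exact He|].
  intros z w s Hs Hz Hw.
  destruct (Hdecay (Cmod z) (Cmod w) s Hs (conj (Cmod_ge_0 z) Hz) (conj (Cmod_ge_0 w) Hw))
    as [Hzr [Hwr Hmon]].
  replace (Series S * (/ e) ^ nu * s ^ nu)%R with ((s / e) ^ nu * Series S)%R
    by (unfold Rdiv; rewrite Rpow_mult_distr; ring).
  rewrite <- Series_scal_l.
  apply (Cmod_is_series_le _ _ _ (Hh z w Hzr Hwr)).
  - apply (ex_series_scal_l (K := R_AbsRing) (V := R_NormedModule)). exact HS.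
  - intros n. unfold S. rewrite <- (sum_n_mult_l (K := R_AbsRing)).
    apply Cmod_sum_n_le. intros j Hj.
    rewrite !Cmod_mult, !Cmod_pow. unfold mult; simpl.
    destruct (Nat.lt_ge_cases (a * j + b * (n - j)) nu) as [Hlt|Hge].
    + rewrite (Hc _ _ Hlt), Cmod_0. lra.
    + specialize (Hmon _ _ Hge). replace (j + (n - j))%nat with n in Hmon by lia.
      apply (Rmult_le_compat_l _ _ _ (Cmod_ge_0 (c j (n - j)%nat))) in Hmon. lra.
Qed.

Lemma power_series3_bound (c : nat -> nat -> nat -> C) (h : C -> R -> R) (a b nu : nat) :
  (0 < a)%nat -> (0 < b)%nat ->
  (forall j k l, (a * (j + k) + b * l < nu)%nat -> c j k l = RtoC 0) ->
  power_series3 c h ->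
  exists e K : R, (0 < e)%R /\ forall (z : C) (u s : R), (0 <= s <= e)%R ->
    (Cmod z <= s ^ a)%R -> (Rabs u <= s ^ b)%R -> (Rabs (h z u) <= K * s ^ nu)%R.
Proof.
  intros Ha Hb Hc [r [Hr [HS Hh]]].
  set (S := fun n => sum_n (fun j => sum_n (fun k =>
    (Cmod (c j k (n - j - k)%nat) * r ^ n)%R) (n - j)) n) in HS.
  destruct (monomial_decay r a b nu Hr Ha Hb) as [e [He Hdecay]].
  exists e, (Series S * (/ e) ^ nu)%R. split; [exact He|].
  intros z u s Hs Hz Hu.
  destruct (Hdecay (Cmod z) (Rabs u) s Hs (conj (Cmod_ge_0 z) Hz) (conj (Rabs_pos u) Hu))
    as [Hzr [Hur Hmon]].
  replace (Series S * (/ e) ^ nu * s ^ nu)%R with ((s / e) ^ nu * Series S)%R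
    by (unfold Rdiv; rewrite Rpow_mult_distr; ring).
  rewrite <- Series_scal_l, <- Cmod_R.
  apply (Cmod_is_series_le _ _ _ (Hh z u Hzr Hur)).
  - apply (ex_series_scal_l (K := R_AbsRing) (V := R_NormedModule)). exact HS.
  - intros n. unfold S. rewrite <- (sum_n_mult_l (K := R_AbsRing)).
    apply Cmod_sum_n_le. intros j Hj.
    rewrite <- (sum_n_mult_l (K := R_AbsRing)).
    apply Cmod_sum_n_le. intros k Hk.
    rewrite !Cmod_mult, !Cmod_pow, Cmod_conj, Cmod_R. unfold mult; simpl.
    destruct (Nat.lt_ge_cases (a * (j + k) + b * (n - j - k)) nu) as [Hlt|Hge].
    + rewrite (Hc _ _ _ Hlt), Cmod_0. lra.
    + specialize (Hmon _ _ Hge). replace (j + k + (n - j - k))%nat with n in Hmon by lia.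
      rewrite pow_add in Hmon.
      apply (Rmult_le_compat_l _ _ _ (Cmod_ge_0 (c j k (n - j - k)%nat))) in Hmon. lra.
Qed.

Lemma power_series2_at_0 (c : nat -> nat -> C) (h : C -> C -> C) :
  power_series2 c h -> h 0 0 = c 0%nat 0%nat.
Proof.
  intros [r [Hr [_ Hh]]].
  assert (H0 : (Cmod 0 < r)%R) by (rewrite Cmod_0; exact Hr).
  specialize (Hh 0 0 H0 H0).
  apply (filterlim_locally_unique _ _ _ Hh).
  apply (filterlim_ext (fun _ => c 0%nat 0%nat)); [|apply filterlim_const].
  intros n. induction n as [|n IH].
  - rewrite !sum_O. simpl. ring.
  - rewrite sum_Sn, <- IH.
    rewrite (sum_n_ext_loc _ (fun _ => zero)).
    + unfold sum_n. rewrite sum_n_m_const_zero. symmetry. apply Cplus_0_r.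
    + intros [|j] Hj; [rewrite Nat.sub_0_r|]; simpl; unfold zero; simpl; ring.
Qed.

(** * Orders of vanishing as t tends to 0 from the right *)

Definition bigO (n : nat) (phi : R -> C) : Prop :=
  exists K : R, at_right 0 (fun t : R => (Cmod (phi t) <= K * t ^ n)%R).

Lemma at_right_pos (d : R) : (0 < d)%R -> at_right 0 (fun t : R => (0 < t < d)%R).
Proof.
  intros Hd. exists (mkposreal d Hd). intros t Ht Hpos.
  unfold ball in Ht; simpl in Ht. unfold AbsRing_ball, abs, minus, plus, opp in Ht; simpl in Ht.
  apply Rabs_def2 in Ht. lra.
Qed.

Lemma bigO_ext (n : nat) (phi psi : R -> C) :
  at_right 0 (fun t => phi t = psi t) -> bigO n phi -> bigO n psi.
Proof.
  intros E [K HK]. exists K.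
  generalize (filter_and _ _ E HK). apply filter_imp.
  intros t [<- Ht]. exact Ht.
Qed.

Lemma bigO_eq (n : nat) (phi psi : R -> C) :
  (forall t, phi t = psi t) -> bigO n phi -> bigO n psi.
Proof. intros E. apply bigO_ext. apply filter_forall. exact E. Qed.

(** Lowering the order is allowed because only [t < 1] matters; the constant is
    replaced by its positive part so that it survives this. *)
Lemma bigO_le (n m : nat) (phi psi : R -> C) :
  (forall t, (Cmod (phi t) <= Cmod (psi t))%R) -> (n <= m)%nat -> bigO m psi -> bigO n phi.
Proof.
  intros E Hnm [K HK]. exists (Rmax K 0).
  generalize (filter_and _ _ (at_right_pos 1 Rlt_0_1) HK). apply filter_imp.
  intros t [Ht Hpsi].
  pose proof (pow_le_pow t n m ltac:(lra) Hnm).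
  pose proof (pow_le t m ltac:(lra)).
  pose proof (Rmax_l K 0). pose proof (Rmax_r K 0). pose proof (E t). nra.
Qed.

Lemma bigO_weaken (n m : nat) (phi : R -> C) : (n <= m)%nat -> bigO m phi -> bigO n phi.
Proof. apply bigO_le. intros; lra. Qed.

Lemma bigO_plus (n : nat) (phi psi : R -> C) :
  bigO n phi -> bigO n psi -> bigO n (fun t => phi t + psi t).
Proof.
  intros [K HK] [L HL]. exists (K + L)%R.
  generalize (filter_and _ _ HK HL). apply filter_imp.
  intros t [H1 H2]. pose proof (Cmod_triangle (phi t) (psi t)). lra.
Qed.

Lemma bigO_minus (n : nat) (phi psi : R -> C) :
  bigO n phi -> bigO n psi -> bigO n (fun t => phi t - psi t).
Proof.
  intros H1 H2. apply bigO_plus; [exact H1|].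
  apply (bigO_le n n _ psi); [intros; rewrite Cmod_opp; lra|lia|exact H2].
Qed.

Lemma bigO_mult (n m : nat) (phi psi : R -> C) :
  bigO n phi -> bigO m psi -> bigO (n + m) (fun t => phi t * psi t).
Proof.
  intros [K HK] [L HL]. exists (K * L)%R.
  generalize (filter_and _ _ HK HL). apply filter_imp.
  intros t [H1 H2]. rewrite Cmod_mult, pow_add.
  replace (K * L * (t ^ n * t ^ m))%R with ((K * t ^ n) * (L * t ^ m))%R by ring.
  apply Rmult_le_compat; auto using Cmod_ge_0.
Qed.

Lemma bigO_conj (n : nat) (phi : R -> C) : bigO n phi -> bigO n (fun t => Cconj (phi t)).
Proof. apply bigO_le; [intros; rewrite Cmod_conj; lra|lia]. Qed.

Lemma bigO_Re (n : nat) (phi : R -> C) : bigO n phi -> bigO n (fun t => RtoC (Re (phi t))).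
Proof. apply bigO_le; [intros; rewrite Cmod_R; apply re_le_Cmod|lia]. Qed.

Lemma bigO_Im (n : nat) (phi : R -> C) : bigO n phi -> bigO n (fun t => RtoC (Im (phi t))).
Proof.
  apply bigO_le; [intros t; rewrite Cmod_R|lia].
  eapply Rle_trans; [apply Rmax_r|apply Rmax_Cmod].
Qed.

Lemma bigO_const (c : C) : bigO 0 (fun _ => c).
Proof. exists (Cmod c). apply filter_forall. intros t. simpl. lra. Qed.

Lemma bigO_t (n : nat) : bigO n (fun t => RtoC t ^ n).
Proof.
  exists 1%R. apply (filter_imp (fun t => (0 < t < 1)%R)); [|apply at_right_pos; lra].
  intros t Ht. rewrite Cmod_pow, Cmod_R, Rabs_pos_eq; lra.
Qed.

Lemma bigO_monomial (n : nat) (c : C) : bigO n (fun t => c * RtoC t ^ n).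
Proof. apply (bigO_mult 0 n _ _ (bigO_const c) (bigO_t n)). Qed.

Lemma bigO_id : bigO 1 (fun t => RtoC t).
Proof. exact (bigO_eq _ _ _ (fun t => Cpow_1_r t) (bigO_t 1)). Qed.

Lemma bigO_small (n : nat) (phi : R -> C) (e : posreal) :
  (0 < n)%nat -> bigO n phi -> at_right 0 (fun t => (Cmod (phi t) < e)%R).
Proof.
  intros Hn HO. apply (bigO_weaken 1) in HO; [|exact Hn]. destruct HO as [K HK].
  assert (He : (0 < e / (Rabs K + 1))%R).
  { apply Rdiv_lt_0_compat; [apply cond_pos|]. pose proof (Rabs_pos K). lra. }
  generalize (filter_and _ _ (at_right_pos _ He) HK). apply filter_imp.
  intros t [[H0 Ht] Hphi]. simpl in Hphi.
  pose proof (Rabs_pos K). pose proof (Rle_abs K).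
  apply (Rmult_lt_compat_l (Rabs K + 1)) in Ht; [|lra].
  replace ((Rabs K + 1) * (e / (Rabs K + 1)))%R with (pos e) in Ht by (field; lra).
  nra.
Qed.

Lemma locally_origin_at_right (P : C2 -> Prop) (z w : R -> C) :
  locally origin P -> bigO 1 z -> bigO 1 w -> at_right 0 (fun t => P (z t, w t)).
Proof.
  intros [e He] Hz Hw.
  generalize (filter_and _ _ (bigO_small 1 z e (le_n 1) Hz) (bigO_small 1 w e (le_n 1) Hw)).
  apply filter_imp. intros t [Hzt Hwt]. apply He.
  assert (Hball : forall x : C, (Cmod x < e)%R -> @ball C_UniformSpace (RtoC 0) e x).
  { intros x Hx. pose proof (Rmax_Cmod x) as Hm.
    pose proof (Rmax_l (Rabs (fst x)) (Rabs (snd x))).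
    pose proof (Rmax_r (Rabs (fst x)) (Rabs (snd x))).
    split; simpl; unfold ball; simpl; unfold AbsRing_ball, abs, minus, plus, opp; simpl;
      rewrite Ropp_0, Rplus_0_r; lra. }
  split; apply Hball; assumption.
Qed.

(** The constants of two bounds are absorbed by rescaling [t] by one factor [L]:
    as [L >= 1] and [a, b > 0], one has [K <= L <= L^a] and likewise for
    [b]. *)
Lemma common_scale (a b : nat) (phi psi : R -> C) (e : R) :
  (0 < a)%nat -> (0 < b)%nat -> (0 < e)%R -> bigO a phi -> bigO b psi ->
  exists L : R, at_right 0 (fun t => (0 <= L * t <= e)%R /\
    (Cmod (phi t) <= (L * t) ^ a)%R /\ (Cmod (psi t) <= (L * t) ^ b)%R).
Proof.
  intros Ha Hb He [K HK] [K' HK'].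
  set (L := (Rmax 1 (Rmax K K'))).
  assert (HL : (1 <= L /\ K <= L /\ K' <= L)%R).
  { unfold L. pose proof (Rmax_l 1 (Rmax K K')). pose proof (Rmax_r 1 (Rmax K K')).
    pose proof (Rmax_l K K'). pose proof (Rmax_r K K'). lra. }
  assert (Hpow : forall n, (0 < n)%nat -> (L <= L ^ n)%R).
  { intros n Hn. rewrite <- (pow_1 L) at 1. apply Rle_pow; [lra|exact Hn]. }
  exists L.
  assert (HeL : (0 < e / L)%R) by (apply Rdiv_lt_0_compat; lra).
  generalize (filter_and _ _ (at_right_pos _ HeL) (filter_and _ _ HK HK')).
  apply filter_imp. intros t [Ht [H1 H2]].
  rewrite !Rpow_mult_distr. repeat split.
  - nra.
  - replace e with (L * (e / L))%R by (field; lra). apply Rmult_le_compat_l; lra.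
  - eapply Rle_trans; [exact H1|]. apply Rmult_le_compat_r; [apply pow_le; lra|].
    pose proof (Hpow a Ha). lra.
  - eapply Rle_trans; [exact H2|]. apply Rmult_le_compat_r; [apply pow_le; lra|].
    pose proof (Hpow b Hb). lra.
Qed.

Lemma bigO_power_series2 (c : nat -> nat -> C) (h : C -> C -> C) (a b nu : nat)
    (z w : R -> C) :
  (0 < a)%nat -> (0 < b)%nat ->
  (forall j l, (a * j + b * l < nu)%nat -> c j l = RtoC 0) ->
  power_series2 c h -> bigO a z -> bigO b w -> bigO nu (fun t => h (z t) (w t)).
Proof.
  intros Ha Hb Hc Hh Hz Hw.
  destruct (power_series2_bound c h a b nu Ha Hb Hc Hh) as [e [K [He HK]]].
  destruct (common_scale a b z w e Ha Hb He Hz Hw) as [L HL].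
  exists (K * L ^ nu)%R. revert HL. apply filter_imp. intros t [H1 [H2 H3]].
  rewrite Rmult_assoc, <- Rpow_mult_distr. apply HK; assumption.
Qed.

Lemma bigO_power_series3 (c : nat -> nat -> nat -> C) (h : C -> R -> R) (a b nu : nat)
    (z : R -> C) (u : R -> R) :
  (0 < a)%nat -> (0 < b)%nat ->
  (forall j k l, (a * (j + k) + b * l < nu)%nat -> c j k l = RtoC 0) ->
  power_series3 c h -> bigO a z -> bigO b (fun t => RtoC (u t)) ->
  bigO nu (fun t => RtoC (h (z t) (u t))).
Proof.
  intros Ha Hb Hc Hh Hz Hu.
  destruct (power_series3_bound c h a b nu Ha Hb Hc Hh) as [e [K [He HK]]].
  destruct (common_scale a b z _ e Ha Hb He Hz Hu) as [L HL].
  exists (K * L ^ nu)%R. revert HL. apply filter_imp. intros t [H1 [H2 H3]].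
  rewrite Cmod_R in *.
  rewrite Rmult_assoc, <- Rpow_mult_distr. apply HK; assumption.
Qed.

(** Horner form, so that the order of vanishing can be peeled off from the head. *)
Definition tpoly (l : list C) (t : R) : C :=
  List.fold_right (fun c acc => c + RtoC t * acc) (RtoC 0) l.

Lemma bigO_tpoly (l : list C) : bigO 0 (tpoly l).
Proof.
  induction l as [|c l IH].
  - apply (bigO_const 0).
  - apply bigO_plus; [apply bigO_const|].
    apply (bigO_weaken 0 1); [lia|].
    exact (bigO_mult 1 0 _ _ bigO_id IH).
Qed.

(** The constant coefficient is a limit, hence zero; dividing by [t] leaves the
    tail with one order less. *)
Lemma bigO_tpoly_coef (l : list C) (n k : nat) :
  bigO n (tpoly l) -> (k < n)%nat -> List.nth k l (RtoC 0) = RtoC 0.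
Proof.
  revert l k. induction n as [|n IH]; intros [|c l] k HO Hk; try lia.
  { destruct k; reflexivity. }
  assert (Hc : c = RtoC 0).
  { apply Cmod_eq_0. apply Rle_antisym; [|apply Cmod_ge_0].
    apply le_epsilon. intros eps Heps.
    assert (H1 : bigO 1 (fun _ => c)).
    { apply (bigO_eq 1 (fun t => tpoly (c :: l) t - RtoC t * tpoly l t));
        [intros t; simpl; ring|].
      apply bigO_minus; [apply (bigO_weaken 1 (S n)); [lia|exact HO]|].
      apply (bigO_mult 1 0 _ _ bigO_id (bigO_tpoly l)). }
    destruct (filter_ex _ (bigO_small 1 _ (mkposreal eps Heps) (le_n 1) H1)) as [t Hlt].
    rewrite Rplus_0_l. apply Rlt_le. exact Hlt. }
  destruct k as [|k]; [exact Hc|]. apply (IH l k); [|lia]. subst c.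
  destruct HO as [K HK]. exists K.
  generalize (filter_and _ _ (at_right_pos 1 Rlt_0_1) HK). apply filter_imp.
  intros t [H0 H1]. simpl in H1.
  rewrite Cplus_0_l, Cmod_mult, Cmod_R, Rabs_pos_eq in H1 by lra.
  apply (Rmult_le_reg_l t); [lra|].
  eapply Rle_trans; [exact H1|]. right. ring.
Qed.

(** * Real-valued polynomial identities in z, its conjugate and u *)

(** On the unit circle this is a trigonometric polynomial with frequencies 1, 3
    and 5: six real unknowns, determined by its values on six distinct lines
    through the origin. *)
Lemma Im_quintic_form_zero (p q s : C) :
  (forall z : C, Im (p * z ^ 5 + q * (z ^ 4 * Cconj z) + s * (z ^ 3 * Cconj z ^ 2)) = 0%R) ->
  p = 0 /\ q = 0 /\ s = 0.
Proof.
  intros E.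
  pose proof (E (1, 0)%R) as E1. pose proof (E (0, 1)%R) as E2.
  pose proof (E (1, 1)%R) as E3. pose proof (E (1, -1)%R) as E4.
  pose proof (E (1, 2)%R) as E5. pose proof (E (2, 1)%R) as E6.
  clear E. destruct p, q, s. simpl in *.
  repeat split; apply injective_projections; simpl; lra.
Qed.

Lemma Im_quartic_form_zero (p q s : C) :
  (forall z : C, Im (p * z ^ 4 + q * (z ^ 3 * Cconj z) + s * (z ^ 2 * Cconj z ^ 2)) = 0%R) ->
  p = 0 /\ q = 0 /\ Im s = 0%R.
Proof.
  intros E.
  pose proof (E (1, 0)%R) as E1. pose proof (E (0, 1)%R) as E2.
  pose proof (E (1, 1)%R) as E3. pose proof (E (1, -1)%R) as E4.
  pose proof (E (1, 2)%R) as E5.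
  clear E. destruct p, q, s. simpl in *.
  repeat split; try apply injective_projections; simpl; lra.
Qed.

Lemma Im_quadratic_zero (A B D : C) :
  (forall u : R, Im (A + u * B + u ^ 2 * D) = 0%R) ->
  Im A = 0%R /\ Im B = 0%R /\ Im D = 0%R.
Proof.
  intros E. pose proof (E 0%R) as E1. pose proof (E 1%R) as E2. pose proof (E (-1)%R) as E3.
  clear E. destruct A, B, D. simpl in *. lra.
Qed.

Lemma Im_mult_R (p : C) (x : R) : Im p = 0%R -> Im (p * x) = 0%R.
Proof. destruct p as [a b]. simpl. intros ->. ring. Qed.

(** The powers of [u] separate, and each remaining form of degree 3 or 1 becomes
    quintic after multiplication by [|z|^2] or [|z|^4].  All odd weights up to
    5 are covered: an identity of weight 3 is multiplied by [u] beforehand. *)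
Lemma Im_odd_weight_zero (p50 p41 p32 p30 p21 p10 : C) :
  (forall (z : C) (u : R),
    Im (p50 * z ^ 5 + p41 * (z ^ 4 * Cconj z) + p32 * (z ^ 3 * Cconj z ^ 2)
        + u * (p30 * z ^ 3 + p21 * (z ^ 2 * Cconj z)) + u ^ 2 * (p10 * z)) = 0%R) ->
  p50 = 0 /\ p41 = 0 /\ p32 = 0 /\ p30 = 0 /\ p21 = 0 /\ p10 = 0.
Proof.
  intros E.
  assert (E' := fun z => Im_quadratic_zero _ _ _ (E z)). clear E.
  destruct (Im_quintic_form_zero p50 p41 p32 (fun z => proj1 (E' z))) as [-> [-> ->]].
  destruct (Im_quintic_form_zero 0 p30 p21) as [_ [-> ->]].
  { intros z. etransitivity; [|exact (Im_mult_R _ (Cmod z ^ 2)%R (proj1 (proj2 (E' z))))].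
    f_equal. rewrite Cmod2_conj. ring. }
  destruct (Im_quintic_form_zero 0 0 p10) as [_ [_ ->]]; [|repeat split].
  intros z. etransitivity; [|exact (Im_mult_R _ ((Cmod z ^ 2) ^ 2)%R (proj2 (proj2 (E' z))))].
  f_equal. rewrite (RtoC_pow (_ ^ 2)), Cmod2_conj. ring.
Qed.

Lemma Im_even_weight_zero (p40 p31 p22 p20 p11 p00 : C) :
  (forall (z : C) (u : R),
    Im (p40 * z ^ 4 + p31 * (z ^ 3 * Cconj z) + p22 * (z ^ 2 * Cconj z ^ 2)
        + u * (p20 * z ^ 2 + p11 * (z * Cconj z)) + u ^ 2 * p00) = 0%R) ->
  p40 = 0 /\ p31 = 0 /\ Im p22 = 0%R /\ p20 = 0 /\ Im p11 = 0%R /\ Im p00 = 0%R.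
Proof.
  intros E.
  assert (E' := fun z => Im_quadratic_zero _ _ _ (E z)). clear E.
  destruct (Im_quartic_form_zero p40 p31 p22 (fun z => proj1 (E' z))) as [-> [-> Hp22]].
  destruct (Im_quartic_form_zero 0 p20 p11) as [_ [-> Hp11]].
  { intros z. etransitivity; [|exact (Im_mult_R _ (Cmod z ^ 2)%R (proj1 (proj2 (E' z))))].
    f_equal. rewrite Cmod2_conj. ring. }
  repeat split; try assumption. exact (proj2 (proj2 (E' 0))).
Qed.

(** * Solving the equations of each weight on the model *)

Lemma weight2_relations (b20 b01 : C) :
  (forall (z : C) (u : R), let w := u + Ci * (z * Cconj z) in
    Im (b20 * z ^ 2 + b01 * w - Ci * (z * Cconj z)) = 0%R) ->
  b20 = 0 /\ b01 = 1.
Proof.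
  intros E.
  destruct (Im_even_weight_zero 0 0 0 b20 (Ci * b01 - Ci) b01) as [_ [_ [_ [H1 [H2 H3]]]]].
  { intros z u. etransitivity; [|exact (Im_mult_R _ u (E z u))]. f_equal. ring. }
  split; [exact H1|]. destruct b01 as [x y]. simpl in *.
  apply injective_projections; simpl; lra.
Qed.

(** The real part of [2 f2 Cconj z] is written as the imaginary part of
    [2 i f2 Cconj z], and the term in [a01 u Cconj z] is then conjugated to
    become one in [u z]; the coefficients passed to [Im_odd_weight_zero] come
    from this expansion. *)
Lemma weight3_relations (b30 b11 a20 a01 : C) :
  (forall (z : C) (u : R), let w := u + Ci * (z * Cconj z) in
    let f1 := z in let f2 := a20 * z ^ 2 + a01 * w in
    Im (b30 * z ^ 3 + b11 * (z * w) - Ci * (f1 * Cconj f2 + f2 * Cconj f1)) = 0%R) ->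
  b30 = 0 /\ b11 = 2 * Ci * Cconj a01 /\ a20 = 2 * Ci * Cconj a01.
Proof.
  intros E.
  destruct (Im_odd_weight_zero 0 0 0 b30 (Ci * b11 - 2 * Ci * a20 - 2 * Cconj a01)
    (b11 - 2 * Ci * Cconj a01)) as [_ [_ [_ [H1 [H2 H3]]]]].
  { intros z u. etransitivity; [|exact (Im_mult_R _ u (E z u))].
    destruct z, b30, b11, a20, a01. simpl. ring. }
  assert (Hb : b11 = 2 * Ci * Cconj a01) by (rewrite <- (Cplus_0_l (2 * _ * _)), <- H3; ring).
  repeat split; try assumption.
  destruct b11, a20, a01. simpl in *.
  injection H2; injection H3; intros.
  apply injective_projections; simpl; lra.
Qed.

(** The coefficients of [u^2], [u |z|^2] and [|z|^4] only give real equations: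
    they determine [b02] and the imaginary part of [a11] from [a01] and the real
    part of [a11], which stays free. *)
Lemma weight4_relations (b40 b21 b02 a20 a01 a30 a11 : C) :
  a20 = 2 * Ci * Cconj a01 ->
  (forall (z : C) (u : R), let w := u + Ci * (z * Cconj z) in
    let f1 := z in let f2 := a20 * z ^ 2 + a01 * w in
    let f3 := a30 * z ^ 3 + a11 * (z * w) in
    Im (b40 * z ^ 4 + b21 * (z ^ 2 * w) + b02 * w ^ 2
        - Ci * (f1 * Cconj f3 + f2 * Cconj f2 + f3 * Cconj f1)) = 0%R) ->
  b40 = 0 /\ b21 = - 4 * Cconj a01 ^ 2 /\ b02 = Ci * a01 * Cconj a01 + Re a11 /\
  a30 = - 4 * Cconj a01 ^ 2 /\ a11 = 3 * Ci * a01 * Cconj a01 + Re a11.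
Proof.
  intros Ha20 E.
  destruct (Im_even_weight_zero b40
    (Ci * b21 - 2 * Ci * a30 - 2 * a20 * Cconj a01)
    (- b02 + 2 * a11 - Ci * (a20 * Cconj a20 + a01 * Cconj a01))
    (b21 - 2 * Ci * a20 * Cconj a01)
    (2 * Ci * b02 - 2 * Ci * a11)
    (b02 - Ci * a01 * Cconj a01)) as [H1 [H2 [H3 [H4 [H5 H6]]]]].
  { intros z u. etransitivity; [|exact (E z u)]. clear E.
    destruct z, b40, b21, b02, a20, a01, a30, a11. simpl. ring. }
  assert (Hb : b21 = - 4 * Cconj a01 ^ 2).
  { rewrite Ha20 in H4. destruct b21, a01. simpl in *. injection H4; intros.
    apply injective_projections; simpl; lra. }
  repeat split; try assumption.
  - destruct b02, a11, a01. simpl in *. apply injective_projections; simpl; lra.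
  - rewrite Ha20 in H2. rewrite Hb in H2. destruct a30, a01. simpl in *. injection H2; intros.
    apply injective_projections; simpl; lra.
  - rewrite Ha20 in H3. destruct b02, a11, a01. simpl in *. apply injective_projections; simpl; lra.
Qed.

(** The equations for [z u^2], [z |z|^2 u] and [z |z|^4] couple [b12], [a21]
    and the conjugate of [a02]: the first plus the third gives [a21], and
    the first two then give the others, so no free parameter remains. *)
Lemma weight5_relations (b50 b31 b12 a20 a01 a30 a11 a40 a21 a02 : C) (r : R) :
  a20 = 2 * Ci * Cconj a01 -> a30 = - 4 * Cconj a01 ^ 2 ->
  a11 = 3 * Ci * a01 * Cconj a01 + r ->
  (forall (z : C) (u : R), let w := u + Ci * (z * Cconj z) in
    let f1 := z in let f2 := a20 * z ^ 2 + a01 * w in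
    let f3 := a30 * z ^ 3 + a11 * (z * w) in
    let f4 := a40 * z ^ 4 + a21 * (z ^ 2 * w) + a02 * w ^ 2 in
    Im (b50 * z ^ 5 + b31 * (z ^ 3 * w) + b12 * (z * w ^ 2)
        - Ci * (f1 * Cconj f4 + f2 * Cconj f3 + f3 * Cconj f2 + f4 * Cconj f1)) = 0%R) ->
  b50 = 0 /\ b31 = - 8 * Ci * Cconj a01 ^ 3 /\
  b12 = 4 * Ci * Cconj a01 * r - 4 * Cconj a01 ^ 2 * a01 /\
  a40 = - 8 * Ci * Cconj a01 ^ 3 /\
  a21 = - 8 * a01 * Cconj a01 ^ 2 + 4 * Ci * Cconj a01 * r /\
  a02 = a01 * r + Ci * a01 ^ 2 * Cconj a01.
Proof.
  intros Ha20 Ha30 Ha11 E.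
  destruct (Im_odd_weight_zero b50
    (Ci * b31 - 2 * Ci * a40 - 2 * a30 * Cconj a01)
    (- b12 + 2 * a21 + 2 * Ci * Cconj a02 - 2 * Ci * a30 * Cconj a20
       - 2 * Cconj a11 * a20 - 2 * Ci * a11 * Cconj a01)
    (b31 - 2 * Ci * a30 * Cconj a01)
    (2 * Ci * b12 - 2 * Ci * a21 - 4 * Cconj a02 - 2 * Ci * Cconj a11 * a20)
    (b12 - 2 * Ci * Cconj a02 - 2 * Ci * a11 * Cconj a01))
    as [H1 [H2 [H3 [H4 [H5 H6]]]]].
  { intros z u. etransitivity; [|exact (E z u)]. clear E Ha20 Ha30 Ha11.
    destruct z, b50, b31, b12, a20, a01, a30, a11, a40, a21, a02. simpl. ring. }
  clear E. subst a20 a30 a11. split; [exact H1|]. clear H1.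
  destruct b31, b12, a01, a40, a21, a02. simpl in *.
  injection H2 as H2a H2b. injection H3 as H3a H3b. injection H4 as H4a H4b.
  injection H5 as H5a H5b. injection H6 as H6a H6b.
  repeat split; apply injective_projections; simpl; lra.
Qed.

(** * The equation of the mapping along weighted curves *)

Lemma Cconj_RtoC (x : R) : Cconj x = x.
Proof. apply injective_projections; simpl; ring. Qed.

Lemma Im_tpoly (l : list C) (t : R) :
  RtoC (Im (tpoly l t)) = tpoly (map (fun c => RtoC (Im c)) l) t.
Proof.
  induction l as [|c l IH]; [reflexivity|].
  change (RtoC (Im (c + t * tpoly l t))
    = RtoC (Im c) + t * tpoly (map (fun c => RtoC (Im c)) l) t).
  rewrite <- IH. generalize (tpoly l t). intros [x y]. destruct c.
  apply injective_projections; simpl; ring.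
Qed.

Definition poly4 (a00 a10 a20 a30 a40 a01 a11 a21 a02 z w : C) : C :=
  a00 + a10 * z + (a20 * z ^ 2 + a01 * w) + (a30 * z ^ 3 + a11 * (z * w))
  + (a40 * z ^ 4 + a21 * (z ^ 2 * w) + a02 * w ^ 2).

Definition poly5 (b00 b10 b20 b30 b40 b50 b01 b11 b21 b31 b02 b12 z w : C) : C :=
  poly4 b00 b10 b20 b30 b40 b01 b11 b21 b02 z w
  + (b50 * z ^ 5 + b31 * (z ^ 3 * w) + b12 * (z * w ^ 2)).

Lemma weighted_poly4_normal_form (f : C -> C -> C) :
  weighted_poly 4 f ->
  exists a00 a10 a20 a30 a40 a01 a11 a21 a02 : C,
    forall z w, f z w = poly4 a00 a10 a20 a30 a40 a01 a11 a21 a02 z w.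
Proof.
  intros [a [Ha Hf]].
  exists (a 0 0)%nat, (a 1 0)%nat, (a 2 0)%nat, (a 3 0)%nat, (a 4 0)%nat,
    (a 0 1)%nat, (a 1 1)%nat, (a 2 1)%nat, (a 0 2)%nat.
  intros z w. rewrite Hf.
  repeat (rewrite ?sum_Sn, ?sum_O).
  repeat match goal with |- context [a ?j ?l] =>
    rewrite (Ha j l) by (simpl; lia) end.
  unfold plus, poly4; simpl. ring.
Qed.

Lemma weighted_poly5_normal_form (g : C -> C -> C) :
  weighted_poly 5 g ->
  exists b00 b10 b20 b30 b40 b50 b01 b11 b21 b31 b02 b12 : C,
    forall z w, g z w = poly5 b00 b10 b20 b30 b40 b50 b01 b11 b21 b31 b02 b12 z w.
Proof.
  intros [b [Hb Hg]].
  exists (b 0 0)%nat, (b 1 0)%nat, (b 2 0)%nat, (b 3 0)%nat, (b 4 0)%nat, (b 5 0)%nat,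
    (b 0 1)%nat, (b 1 1)%nat, (b 2 1)%nat, (b 3 1)%nat, (b 0 2)%nat, (b 1 2)%nat.
  intros z w. rewrite Hg.
  repeat (rewrite ?sum_Sn, ?sum_O).
  repeat match goal with |- context [b ?j ?l] =>
    rewrite (Hb j l) by (simpl; lia) end.
  unfold plus, poly5, poly4; simpl. ring.
Qed.

Lemma weighted_O2_at_0 (nu : nat) (h : C -> C -> C) : weighted_O2 (S nu) h -> h 0 0 = 0.
Proof.
  intros [c [Hc Hh]]. rewrite (power_series2_at_0 c h Hh). apply Hc. lia.
Qed.

Lemma bigO_weighted_O2 (nu : nat) (h : C -> C -> C) (z w : R -> C) :
  weighted_O2 nu h -> bigO 1 z -> bigO 2 w -> bigO nu (fun t => h (z t) (w t)).
Proof.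
  intros [c [Hc Hh]]. apply (bigO_power_series2 c); try lia; [|exact Hh].
  intros j l Hjl. apply Hc. lia.
Qed.

Lemma bigO_weighted_O3 (nu : nat) (h : C -> R -> R) (z : R -> C) (u : R -> R) :
  weighted_O3 nu h -> bigO 1 z -> bigO 2 (fun t => RtoC (u t)) ->
  bigO nu (fun t => RtoC (h (z t) (u t))).
Proof.
  intros [c [Hc Hh]]. apply (bigO_power_series3 c); try lia; [|exact Hh].
  intros j k l Hjl. apply Hc. lia.
Qed.

Lemma bigO_holomorphic_germ (n : nat) (h : C -> C -> C) (z w : R -> C) :
  (0 < n)%nat ->
  holomorphic_germ h -> h 0 0 = 0 -> bigO n z -> bigO n w -> bigO n (fun t => h (z t) (w t)).
Proof.
  intros Hn [c Hh] H0. apply (bigO_power_series2 c); try lia; [|exact Hh].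
  intros [|j] [|l] Hjl; try lia.
  rewrite <- (power_series2_at_0 c h Hh). exact H0.
Qed.

(** The curve is [z = t z0], [u = t^2 u0], lifted to [M] by solving for [v].
    The orders 1 of both components of [H] are enough to enter the
    neighbourhood where the equation of [M'] is valid. *)
Lemma mapping_equation_on_curve (M M' : C2 -> Prop) (H : C2 -> C2) (z0 : C) (u0 : R) :
  hypersurface_germ M -> hypersurface_germ M' ->
  holomorphic_map_germ H -> H origin = origin -> sends_germ H M M' ->
  exists (W : R -> C) (rho' : C -> R -> R),
    bigO 6 (fun t => W t - RtoC t ^ 2 * (u0 + Ci * (z0 * Cconj z0))) /\
    weighted_O3 6 rho' /\
    bigO 1 (fun t => fst (H (t * z0, W t))) /\ bigO 1 (fun t => snd (H (t * z0, W t))) /\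
    at_right 0 (fun t => let F := fst (H (t * z0, W t)) in let G := snd (H (t * z0, W t)) in
      RtoC (Im (G - Ci * (F * Cconj F))) = RtoC (rho' F (Re G))).
Proof.
  intros [rho [Hrho HM]] [rho' [Hrho' HM']] [HF HG] H0 Hsend.
  set (z := fun t : R => t * z0).
  set (u := fun t : R => (t ^ 2 * u0)%R).
  set (W := fun t : R => u t + Ci * (z t * Cconj (z t) + rho (z t) (u t))).
  exists W, rho'.
  assert (Hz : bigO 1 z) by (apply (bigO_mult 1 0 _ _ bigO_id (bigO_const z0))).
  assert (Hu : bigO 2 (fun t => RtoC (u t))).
  { apply (bigO_eq 2 (fun t => RtoC t ^ 2 * u0)).
    - intros t. unfold u. rewrite RtoC_mult, RtoC_pow. reflexivity.
    - apply (bigO_mult 2 0 _ _ (bigO_t 2) (bigO_const u0)). }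
  assert (HW : bigO 6 (fun t => W t - RtoC t ^ 2 * (u0 + Ci * (z0 * Cconj z0)))).
  { apply (bigO_eq 6 (fun t => Ci * rho (z t) (u t))).
    - intros t. unfold W, u, z. rewrite Cmult_conj, Cconj_RtoC, RtoC_mult, RtoC_pow. ring.
    - apply (bigO_mult 0 6 _ _ (bigO_const Ci)). exact (bigO_weighted_O3 6 rho z u Hrho Hz Hu). }
  assert (HW1 : bigO 1 W).
  { apply (bigO_eq 1 (fun t => (W t - RtoC t ^ 2 * (u0 + Ci * (z0 * Cconj z0)))
      + (u0 + Ci * (z0 * Cconj z0)) * RtoC t ^ 2)); [intros t; ring|].
    apply bigO_plus; [apply (bigO_weaken 1 6); [lia|exact HW]|].
    apply (bigO_weaken 1 2); [lia|apply bigO_monomial]. }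
  assert (HF1 : bigO 1 (fun t => fst (H (z t, W t)))).
  { apply (bigO_holomorphic_germ 1 (fun x y => fst (H (x, y)))); auto.
    change (fst (H origin) = RtoC 0). rewrite H0. reflexivity. }
  assert (HG1 : bigO 1 (fun t => snd (H (z t, W t)))).
  { apply (bigO_holomorphic_germ 1 (fun x y => snd (H (x, y)))); auto.
    change (snd (H origin) = RtoC 0). rewrite H0. reflexivity. }
  repeat split; try assumption.
  generalize (filter_and _ _ (locally_origin_at_right _ z W HM Hz HW1)
    (filter_and _ _ (locally_origin_at_right _ z W Hsend Hz HW1)
       (locally_origin_at_right _ _ _ HM' HF1 HG1))).
  apply filter_imp. intros t [HMt [Hst HMt']]. fold (z t).
  rewrite <- surjective_pairing in HMt'.
  assert (Hin : M (z t, W t)).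
  { apply HMt. cbn [fst snd].
    assert (HRe : Re (W t) = u t).
    { unfold W. destruct (z t). simpl. ring. }
    rewrite HRe. unfold W. generalize (z t) (u t) (rho (z t) (u t)).
    intros [x y] v q. apply injective_projections; simpl; ring. }
  apply Hst, HMt' in Hin. cbv zeta. cbn [fst snd] in Hin.
  set (F := fst (H (z t, W t))) in *. set (G := snd (H (z t, W t))) in *.
  clearbody F G. destruct F as [x y]. destruct G as [v w].
  injection Hin as Hin1 Hin2. simpl in *. f_equal. rewrite Hin1. ring.
Qed.

(** The order [n] of the equation is a parameter: it is 2 for a first reading,
    and 6 once that has shown [g1 = 0]. *)
Lemma weight_equations (F G : R -> C) (f1 f2 f3 f4 g1 g2 g3 g4 g5 : C) (n : nat) :
  bigO 5 (fun t => F t - (t * f1 + t ^ 2 * f2 + t ^ 3 * f3 + t ^ 4 * f4)) ->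
  bigO 6 (fun t => G t - (t * g1 + t ^ 2 * g2 + t ^ 3 * g3 + t ^ 4 * g4 + t ^ 5 * g5)) ->
  (n <= 6)%nat ->
  bigO n (fun t => RtoC (Im (G t - Ci * (F t * Cconj (F t))))) ->
  forall k, (k < n)%nat ->
  Im (nth k [RtoC 0; g1; g2 - Ci * (f1 * Cconj f1);
    g3 - Ci * (f1 * Cconj f2 + f2 * Cconj f1);
    g4 - Ci * (f1 * Cconj f3 + f2 * Cconj f2 + f3 * Cconj f1);
    g5 - Ci * (f1 * Cconj f4 + f2 * Cconj f3 + f3 * Cconj f2 + f4 * Cconj f1)] 0) = 0%R.
Proof.
  intros HF HG Hn HR k Hk.
  set (l := [_; _; _; _; _; _]).
  set (f := fun t : R => t * f1 + t ^ 2 * f2 + t ^ 3 * f3 + t ^ 4 * f4) in *.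
  set (g := fun t : R => t * g1 + t ^ 2 * g2 + t ^ 3 * g3 + t ^ 4 * g4 + t ^ 5 * g5) in *.
  assert (Hf : bigO 1 f).
  { apply (bigO_eq 1 (fun t => RtoC t * tpoly [f1; f2; f3; f4] t)).
    - intros t. unfold f. simpl. ring.
    - apply (bigO_mult 1 0 _ _ bigO_id (bigO_tpoly _)). }
  assert (HF1 : bigO 1 F).
  { apply (bigO_eq 1 (fun t => (F t - f t) + f t)); [intros t; ring|].
    apply bigO_plus; [apply (bigO_weaken 1 5); [lia|exact HF]|exact Hf]. }
  assert (Hl : bigO 6 (fun t => G t - Ci * (F t * Cconj (F t)) - tpoly l t)).
  { (* The products of weights 6, 7 and 8 in [f * Cconj f]. *)
    set (tail := [f2 * Cconj f4 + f3 * Cconj f3 + f4 * Cconj f2;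
      f3 * Cconj f4 + f4 * Cconj f3; f4 * Cconj f4]).
    apply (bigO_eq 6 (fun t => (G t - g t)
      - Ci * ((F t - f t) * Cconj (F t) + f t * Cconj (F t - f t))
      - Ci * (RtoC t ^ 6 * tpoly tail t))).
    - intros t. unfold f, g, l, tail. simpl.
      rewrite Cminus_conj, !Cplus_conj, !Cmult_conj, !Cconj_RtoC. ring.
    - apply bigO_minus; [apply bigO_minus|].
      + exact HG.
      + apply (bigO_mult 0 6); [apply bigO_const|]. apply bigO_plus.
        * apply (bigO_mult 5 1); [exact HF|apply bigO_conj; exact HF1].
        * apply (bigO_mult 1 5); [exact Hf|apply bigO_conj; exact HF].
      + apply (bigO_mult 0 6); [apply bigO_const|].
        apply (bigO_mult 6 0); [apply bigO_t|apply bigO_tpoly]. }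
  assert (HIm : bigO n (tpoly (map (fun c => RtoC (Im c)) l))).
  { apply (bigO_eq n (fun t => RtoC (Im (G t - Ci * (F t * Cconj (F t))))
      - RtoC (Im (G t - Ci * (F t * Cconj (F t)) - tpoly l t)))).
    - intros t. rewrite <- Im_tpoly.
      generalize (tpoly l t) (G t - Ci * (F t * Cconj (F t))). intros [x y] [x' y'].
      apply injective_projections; simpl; ring.
    - apply bigO_minus; [exact HR|]. apply (bigO_weaken n 6); [exact Hn|].
      apply bigO_Im in Hl. exact Hl. }
  apply (bigO_tpoly_coef _ _ k) in HIm; [|exact Hk].
  change (RtoC 0) with ((fun c : C => RtoC (Im c)) 0) in HIm. rewrite map_nth in HIm.
  injection HIm as HIm. exact HIm.
Qed.

(** The increment is divisible by [W t - t^2 w0].  It allows the jet of [H]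
    to be evaluated on the model instead of on [M]. *)
Lemma poly4_increment (a00 a10 a20 a30 a40 a01 a11 a21 a02 z0 w0 : C) (W : R -> C) (n : nat) :
  let f := poly4 a00 a10 a20 a30 a40 a01 a11 a21 a02 in
  bigO n (fun t => W t - RtoC t ^ 2 * w0) ->
  bigO n (fun t => f (t * z0) (W t) - f (t * z0) (RtoC t ^ 2 * w0)).
Proof.
  intros f HW.
  apply (bigO_eq n (fun t => (W t - RtoC t ^ 2 * w0)
    * (tpoly [a01; a11 * z0; a21 * z0 ^ 2 + 2 * a02 * w0] t
       + a02 * (W t - RtoC t ^ 2 * w0)))).
  { intros t. unfold f, poly4, tpoly. simpl. ring. }
  rewrite <- (Nat.add_0_r n). apply bigO_mult; [exact HW|].
  apply bigO_plus; [apply bigO_tpoly|].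
  apply (bigO_mult 0 0); [apply bigO_const|].
  apply (bigO_weaken 0 n); [lia|exact HW].
Qed.

Lemma poly5_increment (b00 b10 b20 b30 b40 b50 b01 b11 b21 b31 b02 b12 z0 w0 : C)
    (W : R -> C) (n : nat) :
  let g := poly5 b00 b10 b20 b30 b40 b50 b01 b11 b21 b31 b02 b12 in
  bigO n (fun t => W t - RtoC t ^ 2 * w0) ->
  bigO n (fun t => g (t * z0) (W t) - g (t * z0) (RtoC t ^ 2 * w0)).
Proof.
  intros g HW.
  set (p := poly4 b00 b10 b20 b30 b40 b01 b11 b21 b02).
  apply (bigO_eq n (fun t => (p (t * z0) (W t) - p (t * z0) (RtoC t ^ 2 * w0))
    + (W t - RtoC t ^ 2 * w0)
    * (tpoly [RtoC 0; RtoC 0; RtoC 0; b31 * z0 ^ 3 + 2 * b12 * z0 * w0] t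
       + RtoC t * b12 * z0 * (W t - RtoC t ^ 2 * w0)))).
  { intros t. unfold g, poly5, p, poly4, tpoly. simpl. ring. }
  apply bigO_plus; [apply poly4_increment; exact HW|].
  rewrite <- (Nat.add_0_r n). apply bigO_mult; [exact HW|].
  apply bigO_plus; [apply bigO_tpoly|].
  apply (bigO_eq 0 (fun t => (b12 * z0) * RtoC t ^ 1 * (W t - RtoC t ^ 2 * w0))).
  { intros t. ring. }
  apply (bigO_mult 0 0).
  - apply (bigO_weaken 0 1); [lia|]. apply bigO_monomial.
  - apply (bigO_weaken 0 n); [lia|exact HW].
Qed.

(** The weights are read twice.  With both components of [H] known to be
    [O(t)], a monomial of weight at least 6 has degree at least 3, so the
    remainder of [M'] is [O(t^3)]; this gives [b10 = 0].  Then the second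
    component is [O(t^2)], the remainder is [O(t^6)], and all weights up to 5
    can be read. *)
Lemma jet_equations (M M' : C2 -> Prop) (H : C2 -> C2)
    (a10 a20 a30 a40 a01 a11 a21 a02 : C)
    (b10 b20 b30 b40 b50 b01 b11 b21 b31 b02 b12 : C) :
  hypersurface_germ M -> hypersurface_germ M' ->
  holomorphic_map_germ H -> H origin = origin -> sends_germ H M M' ->
  weighted_O2 5 (fun z w => fst (H (z, w)) - poly4 0 a10 a20 a30 a40 a01 a11 a21 a02 z w) ->
  weighted_O2 6 (fun z w => snd (H (z, w))
    - poly5 0 b10 b20 b30 b40 b50 b01 b11 b21 b31 b02 b12 z w) ->
  b10 = 0 /\
  forall (z : C) (u : R), let w := u + Ci * (z * Cconj z) in
    let f1 := a10 * z in let f2 := a20 * z ^ 2 + a01 * w in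
    let f3 := a30 * z ^ 3 + a11 * (z * w) in
    let f4 := a40 * z ^ 4 + a21 * (z ^ 2 * w) + a02 * w ^ 2 in
    Im (b20 * z ^ 2 + b01 * w - Ci * (f1 * Cconj f1)) = 0%R /\
    Im (b30 * z ^ 3 + b11 * (z * w) - Ci * (f1 * Cconj f2 + f2 * Cconj f1)) = 0%R /\
    Im (b40 * z ^ 4 + b21 * (z ^ 2 * w) + b02 * w ^ 2
        - Ci * (f1 * Cconj f3 + f2 * Cconj f2 + f3 * Cconj f1)) = 0%R /\
    Im (b50 * z ^ 5 + b31 * (z ^ 3 * w) + b12 * (z * w ^ 2)
        - Ci * (f1 * Cconj f4 + f2 * Cconj f3 + f3 * Cconj f2 + f4 * Cconj f1)) = 0%R.
Proof.
  intros HM HM' Hol H0 Hsend Hf Hg.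
  set (f := poly4 _ _ _ _ _ _ _ _ _) in Hf.
  set (g := poly5 _ _ _ _ _ _ _ _ _ _ _ _) in Hg.
  assert (Hcurve : forall (z : C) (u : R), exists (F G : R -> C) (rho' : C -> R -> R),
    let w := u + Ci * (z * Cconj z) in
    weighted_O3 6 rho' /\ bigO 1 F /\ bigO 1 G /\
    at_right 0 (fun t => RtoC (rho' (F t) (Re (G t))) = RtoC (Im (G t - Ci * (F t * Cconj (F t))))) /\
    bigO 5 (fun t => F t - f (t * z) (RtoC t ^ 2 * w)) /\
    bigO 6 (fun t => G t - g (t * z) (RtoC t ^ 2 * w))).
  { intros z u.
    destruct (mapping_equation_on_curve M M' H z u HM HM' Hol H0 Hsend)
      as [W [rho' [HW [Hrho' [HF1 [HG1 Heq]]]]]].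
    exists (fun t : R => fst (H (t * z, W t))), (fun t : R => snd (H (t * z, W t))), rho'.
    set (w := u + Ci * (z * Cconj z)) in *. cbv zeta.
    assert (Hz1 : bigO 1 (fun t => t * z)) by (apply (bigO_mult 1 0 _ _ bigO_id (bigO_const z))).
    assert (HW2 : bigO 2 W).
    { apply (bigO_eq 2 (fun t => (W t - RtoC t ^ 2 * w) + w * RtoC t ^ 2)); [intros t; ring|].
      apply bigO_plus; [apply (bigO_weaken 2 6); [lia|exact HW]|apply bigO_monomial]. }
    repeat split; try assumption.
    - revert Heq. apply filter_imp. intros t E. symmetry. exact E.
    - apply (bigO_eq 5 (fun t => (fst (H (t * z, W t)) - f (t * z) (W t))
        + (f (t * z) (W t) - f (t * z) (RtoC t ^ 2 * w)))); [intros t; ring|].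
      apply bigO_plus; [exact (bigO_weighted_O2 5 _ _ _ Hf Hz1 HW2)|].
      apply (bigO_weaken 5 6); [lia|]. apply poly4_increment; exact HW.
    - apply (bigO_eq 6 (fun t => (snd (H (t * z, W t)) - g (t * z) (W t))
        + (g (t * z) (W t) - g (t * z) (RtoC t ^ 2 * w)))); [intros t; ring|].
      apply bigO_plus; [exact (bigO_weighted_O2 6 _ _ _ Hg Hz1 HW2)|].
      apply poly5_increment; exact HW. }
  assert (Hweights : forall (z : C) (u : R) (F G : R -> C) (n k : nat),
    let w := u + Ci * (z * Cconj z) in
    let f1 := a10 * z in let f2 := a20 * z ^ 2 + a01 * w in
    let f3 := a30 * z ^ 3 + a11 * (z * w) in
    let f4 := a40 * z ^ 4 + a21 * (z ^ 2 * w) + a02 * w ^ 2 in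
    bigO 5 (fun t => F t - f (t * z) (RtoC t ^ 2 * w)) ->
    bigO 6 (fun t => G t - g (t * z) (RtoC t ^ 2 * w)) ->
    (n <= 6)%nat ->
    bigO n (fun t => RtoC (Im (G t - Ci * (F t * Cconj (F t))))) ->
    (k < n)%nat ->
    Im (nth k [RtoC 0; b10 * z; b20 * z ^ 2 + b01 * w - Ci * (f1 * Cconj f1);
      b30 * z ^ 3 + b11 * (z * w) - Ci * (f1 * Cconj f2 + f2 * Cconj f1);
      b40 * z ^ 4 + b21 * (z ^ 2 * w) + b02 * w ^ 2
        - Ci * (f1 * Cconj f3 + f2 * Cconj f2 + f3 * Cconj f1);
      b50 * z ^ 5 + b31 * (z ^ 3 * w) + b12 * (z * w ^ 2)
        - Ci * (f1 * Cconj f4 + f2 * Cconj f3 + f3 * Cconj f2 + f4 * Cconj f1)] 0) = 0%R).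
  { intros z u F G n k w f1 f2 f3 f4 HF HG Hn HR Hk.
    apply (weight_equations F G f1 f2 f3 f4 (b10 * z) (b20 * z ^ 2 + b01 * w)
      (b30 * z ^ 3 + b11 * (z * w)) (b40 * z ^ 4 + b21 * (z ^ 2 * w) + b02 * w ^ 2)
      (b50 * z ^ 5 + b31 * (z ^ 3 * w) + b12 * (z * w ^ 2)) n); try assumption.
    - revert HF. apply bigO_eq. intros t. unfold f, poly4, f1, f2, f3, f4. ring.
    - revert HG. apply bigO_eq. intros t. unfold g, poly5, poly4. ring. }
  assert (Hb10 : b10 = 0).
  { (* The weight 1 equation, multiplied by [u ^ 2]. *)
    apply (Im_odd_weight_zero 0 0 0 0 0 b10). intros z u.
    destruct (Hcurve z u) as [F [G [rho' [[c [Hc Hrho]] [HF1 [HG1 [Heq [HF HG]]]]]]]].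
    assert (E : Im (b10 * z) = 0%R).
    { refine (Hweights z u F G 2%nat 1%nat HF HG _ _ _); try lia.
      apply (bigO_ext 2 _ _ Heq). apply (bigO_weaken 2 3); [lia|].
      apply (bigO_power_series3 c rho' 1 1 3); try lia; try assumption.
      - intros j k l Hjkl. apply Hc. lia.
      - apply bigO_Re. exact HG1. }
    etransitivity; [|exact (Im_mult_R _ (u ^ 2) E)]. f_equal. rewrite RtoC_pow. ring. }
  split; [exact Hb10|]. intros z u w f1 f2 f3 f4.
  destruct (Hcurve z u) as [F [G [rho' [Hrho [HF1 [HG1 [Heq [HF HG]]]]]]]].
  assert (HG2 : bigO 2 G).
  { apply (bigO_eq 2 (fun t => (G t - g (t * z) (RtoC t ^ 2 * w)) + RtoC t ^ 2 *
      tpoly [b20 * z ^ 2 + b01 * w; b30 * z ^ 3 + b11 * (z * w);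
        b40 * z ^ 4 + b21 * (z ^ 2 * w) + b02 * w ^ 2;
        b50 * z ^ 5 + b31 * (z ^ 3 * w) + b12 * (z * w ^ 2)] t)).
    - intros t. unfold g, poly5, poly4, tpoly. rewrite Hb10. simpl. ring.
    - apply bigO_plus; [apply (bigO_weaken 2 6); [lia|exact HG]|].
      apply (bigO_mult 2 0); [apply bigO_t|apply bigO_tpoly]. }
  assert (HR : bigO 6 (fun t => RtoC (Im (G t - Ci * (F t * Cconj (F t)))))).
  { apply (bigO_ext 6 _ _ Heq). apply bigO_weighted_O3; try assumption.
    apply bigO_Re. exact HG2. }
  pose proof (fun k => Hweights z u F G 6%nat k HF HG (le_n 6) HR) as Hk.
  exact (conj (Hk 2%nat ltac:(lia)) (conj (Hk 3%nat ltac:(lia))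
    (conj (Hk 4%nat ltac:(lia)) (Hk 5%nat ltac:(lia))))).
Qed.

(** If the coefficient vanished, [H (t, 0)] would be [O(t^2)], hence so would
    [K (H (t, 0)) = (t, 0)]. *)
Lemma local_biholomorphism_linear_coef_neq_0 (H : C2 -> C2)
    (a10 a20 a30 a40 a01 a11 a21 a02 : C)
    (b20 b30 b40 b50 b01 b11 b21 b31 b02 b12 : C) :
  local_biholomorphism H ->
  weighted_O2 5 (fun z w => fst (H (z, w)) - poly4 0 a10 a20 a30 a40 a01 a11 a21 a02 z w) ->
  weighted_O2 6 (fun z w => snd (H (z, w))
    - poly5 0 0 b20 b30 b40 b50 b01 b11 b21 b31 b02 b12 z w) ->
  a10 <> 0.
Proof.
  intros [_ [_ [K [[HK _] [HK0 [HKH _]]]]]] Hf Hg Ha10. subst a10.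
  assert (H00 : bigO 2 (fun _ : R => RtoC 0)).
  { exists 0%R. apply filter_forall. intros t. rewrite Cmod_0. lra. }
  assert (HF : bigO 2 (fun t => fst (H (RtoC t, RtoC 0)))).
  { apply (bigO_eq 2 (fun t => (fst (H (RtoC t, RtoC 0))
      - poly4 0 0 a20 a30 a40 a01 a11 a21 a02 (RtoC t) (RtoC 0))
      + RtoC t ^ 2 * tpoly [a20; a30; a40] t)).
    - intros t. unfold poly4, tpoly. simpl. ring.
    - apply bigO_plus.
      + apply (bigO_weaken 2 5); [lia|].
        exact (bigO_weighted_O2 5 _ _ (fun _ => RtoC 0) Hf bigO_id H00).
      + apply (bigO_mult 2 0); [apply bigO_t|apply bigO_tpoly]. }
  assert (HG : bigO 2 (fun t => snd (H (RtoC t, RtoC 0)))).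
  { apply (bigO_eq 2 (fun t => (snd (H (RtoC t, RtoC 0))
      - poly5 0 0 b20 b30 b40 b50 b01 b11 b21 b31 b02 b12 (RtoC t) (RtoC 0))
      + RtoC t ^ 2 * tpoly [b20; b30; b40; b50] t)).
    - intros t. unfold poly5, poly4, tpoly. simpl. ring.
    - apply bigO_plus.
      + apply (bigO_weaken 2 6); [lia|].
        exact (bigO_weighted_O2 6 _ _ (fun _ => RtoC 0) Hg bigO_id H00).
      + apply (bigO_mult 2 0); [apply bigO_t|apply bigO_tpoly]. }
  assert (Hid : bigO 2 (tpoly [RtoC 0; RtoC 1])).
  { apply (bigO_ext 2 (fun t =>
      fst (K (fst (H (RtoC t, RtoC 0)), snd (H (RtoC t, RtoC 0)))))).
    - generalize (locally_origin_at_right _ _ (fun _ => RtoC 0) HKH bigO_id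
        (bigO_weaken 1 2 _ (le_S _ _ (le_n 1)) H00)).
      apply filter_imp. intros t E. rewrite <- surjective_pairing, E. simpl. ring.
    - apply (bigO_holomorphic_germ 2 (fun x y => fst (K (x, y)))); auto.
      change (fst (K origin) = RtoC 0). rewrite HK0. reflexivity. }
  pose proof (bigO_tpoly_coef _ 2 1 Hid (le_n 2)) as E. simpl in E.
  injection E. lra.
Qed.

(** * The normal form of the jet *)

Lemma weighted_O2_eq (nu : nat) (h k : C -> C -> C) :
  (forall z w, h z w = k z w) -> weighted_O2 nu h -> weighted_O2 nu k.
Proof.
  intros E [c [Hc [r [Hr [HS Hh]]]]]. exists c. split; [exact Hc|].
  exists r. split; [exact Hr|]. split; [exact HS|].
  intros z w Hz Hw. rewrite <- E. exact (Hh z w Hz Hw).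
Qed.

Theorem proposition2p4
  (M M' : C2 -> Prop) (hM : hypersurface_germ M) (hM' : hypersurface_germ M')
  (H : C2 -> C2) (hH : local_biholomorphism H) (hMM' : sends_germ H M M')
  (f g : C -> C -> C) (hf : weighted_poly 4 f) (hg : weighted_poly 5 g)
  (hHf : weighted_O2 5 (fun z w : C => fst (H (z, w)) - f z w))
  (hHg : weighted_O2 6 (fun z w : C => snd (H (z, w)) - g z w)) :
  exists (lambda alpha : C) (r : R), lambda <> RtoC 0 /\
    (forall z w : C,
      f z w =
        lambda * z
        + 2 * Ci * lambda * Cconj alpha * z ^ 2
        - 4 * lambda * Cconj alpha ^ 2 * z ^ 3
        - 8 * Ci * lambda * Cconj alpha ^ 3 * z ^ 4
        + lambda * alpha * w
        + (3 * Ci * lambda * alpha * Cconj alpha + lambda * r) * (z * w)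
        + (- 8 * lambda * alpha * Cconj alpha ^ 2
           + 4 * Ci * Cconj alpha * lambda * r) * (z ^ 2 * w)
        + (lambda * alpha * r + Ci * lambda * alpha ^ 2 * Cconj alpha) * w ^ 2) /\
    (forall z w : C,
      g z w =
        lambda * Cconj lambda * w
        + 2 * Ci * lambda * Cconj lambda * Cconj alpha * (z * w)
        - 4 * lambda * Cconj lambda * Cconj alpha ^ 2 * (z ^ 2 * w)
        - 8 * Ci * lambda * Cconj lambda * Cconj alpha ^ 3 * (z ^ 3 * w)
        + (Ci * lambda * Cconj lambda * alpha * Cconj alpha
           + lambda * Cconj lambda * r) * w ^ 2
        + (4 * Ci * lambda * Cconj lambda * Cconj alpha * r
           - 4 * lambda * Cconj lambda * Cconj alpha ^ 2 * alpha) * (z * w ^ 2)).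
Proof.
  destruct (weighted_poly4_normal_form f hf)
    as [a00 [a10 [a20 [a30 [a40 [a01 [a11 [a21 [a02 Hf]]]]]]]]].
  destruct (weighted_poly5_normal_form g hg)
    as [b00 [b10 [b20 [b30 [b40 [b50 [b01 [b11 [b21 [b31 [b02 [b12 Hg]]]]]]]]]]]].
  destruct hH as [Hol [H0 HK]].
  assert (Ha00 : a00 = 0).
  { transitivity (f 0 0); [rewrite Hf; unfold poly4; ring|].
    symmetry. apply Ceq_minus. pose proof (weighted_O2_at_0 4 _ hHf) as Eq. cbv beta in Eq.
    change (@pair C C (RtoC 0) (RtoC 0)) with origin in Eq. rewrite H0 in Eq. exact Eq. }
  assert (Hb00 : b00 = 0).
  { transitivity (g 0 0); [rewrite Hg; unfold poly5, poly4; ring|].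
    symmetry. apply Ceq_minus. pose proof (weighted_O2_at_0 5 _ hHg) as Eq. cbv beta in Eq.
    change (@pair C C (RtoC 0) (RtoC 0)) with origin in Eq. rewrite H0 in Eq. exact Eq. }
  subst a00 b00.
  apply (weighted_O2_eq 5 _ (fun z w => fst (H (z, w)) - poly4 0 a10 a20 a30 a40 a01 a11 a21 a02 z w)) in hHf;
    [|intros; rewrite Hf; reflexivity].
  apply (weighted_O2_eq 6 _ (fun z w => snd (H (z, w)) - poly5 0 b10 b20 b30 b40 b50 b01 b11 b21 b31 b02 b12 z w)) in hHg;
    [|intros; rewrite Hg; reflexivity].
  destruct (jet_equations M M' H _ _ _ _ _ _ _ _ _ _ _ _ _ _ _ _ _ _ _
    hM hM' Hol H0 hMM' hHf hHg) as [-> E].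
  pose proof (local_biholomorphism_linear_coef_neq_0 H _ _ _ _ _ _ _ _ _ _ _ _ _ _ _ _ _ _
    (conj Hol (conj H0 HK)) hHf hHg) as Hlambda.
  clear hHf hHg hM hM' hMM' Hol H0 HK.
  (* Dividing by the positive real [mu] keeps the imaginary parts zero, which
     reduces the equations to those with [lambda = 1]. *)
  rename a10 into lambda.
  set (mu := lambda * Cconj lambda) in *.
  assert (Hmu : mu = RtoC (Cmod lambda ^ 2)) by (symmetry; apply Cmod2_conj).
  assert (Hmod : (0 < Cmod lambda ^ 2)%R) by (apply pow_lt, Cmod_gt_0, Hlambda).
  assert (Hmu0 : mu <> 0).
  { rewrite Hmu. intros E0. injection E0. lra. }
  assert (Hfac : forall d x : C, d <> 0 -> exists y, x = d * y).
  { intros d x Hd. exists (x / d). field. exact Hd. }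
  assert (Hdiv : forall p q : C, Im p = 0%R -> p = mu * q -> Im q = 0%R).
  { intros p q Hp ->. rewrite <- (Im_mult_R _ (/ (Cmod lambda ^ 2)) Hp).
    f_equal. rewrite RtoC_inv, <- Hmu by lra. field. exact Hmu0. }
  destruct (Hfac lambda a20 Hlambda) as [A20 ->]. destruct (Hfac lambda a01 Hlambda) as [A01 ->].
  destruct (Hfac lambda a30 Hlambda) as [A30 ->]. destruct (Hfac lambda a11 Hlambda) as [A11 ->].
  destruct (Hfac lambda a40 Hlambda) as [A40 ->]. destruct (Hfac lambda a21 Hlambda) as [A21 ->].
  destruct (Hfac lambda a02 Hlambda) as [A02 ->].
  destruct (Hfac mu b20 Hmu0) as [B20 ->]. destruct (Hfac mu b01 Hmu0) as [B01 ->].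
  destruct (Hfac mu b30 Hmu0) as [B30 ->]. destruct (Hfac mu b11 Hmu0) as [B11 ->].
  destruct (Hfac mu b40 Hmu0) as [B40 ->]. destruct (Hfac mu b21 Hmu0) as [B21 ->].
  destruct (Hfac mu b02 Hmu0) as [B02 ->]. destruct (Hfac mu b50 Hmu0) as [B50 ->].
  destruct (Hfac mu b31 Hmu0) as [B31 ->]. destruct (Hfac mu b12 Hmu0) as [B12 ->].
  destruct (weight2_relations B20 B01) as [-> ->].
  { intros z u w. apply (Hdiv _ _ (proj1 (E z u))). unfold mu. fold w.
    rewrite !Cmult_conj. ring. }
  destruct (weight3_relations B30 B11 A20 A01) as [-> [-> HA20]].
  { intros z u w f1 f2. apply (Hdiv _ _ (proj1 (proj2 (E z u)))). unfold mu, f1, f2. fold w.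
    rewrite !Cplus_conj, !Cmult_conj. ring. }
  destruct (weight4_relations B40 B21 B02 A20 A01 A30 A11 HA20) as [-> [-> [-> [HA30 HA11]]]].
  { intros z u w f1 f2 f3. apply (Hdiv _ _ (proj1 (proj2 (proj2 (E z u))))).
    unfold mu, f1, f2, f3. fold w. rewrite !Cplus_conj, !Cmult_conj. ring. }
  destruct (weight5_relations B50 B31 B12 A20 A01 A30 A11 A40 A21 A02 (Re A11) HA20 HA30 HA11)
    as [-> [-> [-> [HA40 [HA21 HA02]]]]].
  { intros z u w f1 f2 f3 f4. apply (Hdiv _ _ (proj2 (proj2 (proj2 (E z u))))).
    unfold mu, f1, f2, f3, f4. fold w. rewrite !Cplus_conj, !Cmult_conj. ring. }
  exists lambda, A01, (Re A11). split; [exact Hlambda|].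
  remember (Re A11) as r eqn:Hr. clear Hr E. subst A20 A30 A11 A40 A21 A02.
  split; intros z w.
  - rewrite Hf. unfold poly4. ring.
  - rewrite Hg. unfold poly5, poly4, mu. ring.
Qed.
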